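(* Let $n\ge 2$, and let $D_i\ge 0$ and $A_{ij}\ge 0$ ($1\le i,j\le n$) be constants such that $A_{ii}>0$ for all $i$ and, for some constants $\pi_i>0$, $\pi_iA_{ij}=\pi_jA_{ji}$ for all $1\le i,j\le n$. Let $u_i^0:\mathbb{T}\to(0,\infty)$, $1\le i\le n$, be continuous and positive. For $M\in\mathbb{N}$, $M\ge 1$, $h=1/M$, $x_k=kh$, let $(u_i(t,x_k))$ be the unique global positive solution of the ODE system $$\partial_t u_i(t,x_k)=D_i[\Delta_h u_i(t,\cdot)](x_k)+\Big[\Delta_h\Big(u_i(t,\cdot)\sum_{j=1}^nA_{ij}u_j(t,\cdot)\Big)\Big](x_k),\qquad u_i(0,x_k)=u_i^0(x_k),$$ for $k=0,\dots,M-1$, $i=1,\dots,n$, with periodic convention $u_i(t,x_M)=u_i(t,x_0)$, $u_i(t,x_{-1})=u_i(t,x_{M-1})$. Then for every $T>0$ there is a constant $C_T>0$ depending only on $T$, the initial data $u_i^0$, and the coefficients $\pi_i,A_{ij},D_i$ (in particular not on $M$) such that $$\sum_{i=1}^n\int_0^T h\sum_{k=0}^{M-1}|(\nabla_h^+u_i)(t,x_k)|^2\,dt\le C_T,$$ and $$\frac{d}{dt}\mathcal{H}^h(u(t,\cdot))\le 0,\qquad \sup_{t\in[0,T]}\mathcal{H}^h(u(t,\cdot))\le C_T,$$ where $$\mathcal{H}^h(u):=\sum_{i=1}^n h\sum_{k=0}^{M-1}\pi_i\big[u_i(x_k)\log(u_i(x_k))-u_i(x_k)+1\big].$$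
   Context: $\mathbb{T}=[0,1)$ is the one-dimensional torus. For functions $f$ on the periodic grid $\{x_k=kh:k=0,\dots,M-1\}$: $(\nabla_h^+f)(x)=\dfrac{f(x+h)-f(x)}{h}$ and $(\Delta_hf)(x)=\dfrac{f(x+h)+f(x-h)-2f(x)}{h^2}$. The ODE system above does have a unique global solution for each $M$, and it is smooth in time and strictly positive. *)

(* Defs.v *)
From HB Require Import structures.
From mathcomp Require Import all_boot all_order all_algebra.
From mathcomp Require Import all_classical all_reals all_analysis.
Set Implicit Arguments.
Unset Strict Implicit.
Unset Printing Implicit Defensive.
Import Order.TTheory GRing.Theory Num.Theory.
Import numFieldNormedType.Exports.
Local Open Scope classical_set_scope.
Local Open Scope ring_scope.

(* Functions on the torus [0,1) are represented by 1-periodic functions on R;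
   continuity on the torus is then ordinary continuity on R. *)
Definition torus_continuous (R : realType) (f : R -> R) : Prop :=
  periodic f 1 /\ continuous f.

Definition mesh (R : realType) (M : nat) : R := M%:R^-1.

Definition gridpt (R : realType) (M : nat) (k : 'I_M) : R := k%:R * mesh R M.

(* A grid function is a map on 'I_M; the periodic convention is carried by the
   cyclic shifts [ordS] (k+1 mod M) and [ord_pred] (k-1 mod M). *)
Definition grad_plus (R : realType) (M : nat) (f : 'I_M -> R) (k : 'I_M) : R :=
  (f (ordS k) - f k) / mesh R M.

Definition laplace (R : realType) (M : nat) (f : 'I_M -> R) (k : 'I_M) : R :=
  (f (ordS k) + f (ord_pred k) - 2 * f k) / mesh R M ^+ 2.

(* Derivative along the time half-line [0, +oo[: the usual two-sided derivative
   when t > 0, and the right derivative when t = 0. *)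
Definition time_derivative (R : realType) (f : R -> R) (t l : R) : Prop :=
  (f s - f t) / (s - t) @[s --> within [set s | 0 <= s] t^'] --> l.

(* Values of u at negative times are irrelevant. *)
Definition positive_global_solution (R : realType) (n M : nat)
    (D : 'I_n -> R) (A : 'M[R]_n) (u0 : 'I_n -> R -> R)
    (u : R -> 'I_n -> 'I_M -> R) : Prop :=
  [/\ forall i k, u 0 i k = u0 i (gridpt R k),
      forall t i k, 0 <= t -> 0 < u t i k
    & forall t i k, 0 <= t ->
        time_derivative (fun s => u s i k) t
          (D i * laplace (u t i) k
           + laplace (fun l => u t i l * \sum_(j < n) A i j * u t j l) k)].

Definition entropy (R : realType) (n M : nat) (p : 'I_n -> R)
    (v : 'I_n -> 'I_M -> R) : R :=
  \sum_(i < n) mesh R M *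
    \sum_(k < M) p i * (v i k * ln (v i k) - v i k + 1).

(* Main.v *)
(** Write [B i j = p i * A i j], which is symmetric by detailed balance. Summing by
    parts, the entropy production on the edge joining the values [a] and [b] of the
    solution contains [\sum_ij B i j (ln b_i - ln a_i)(b_i b_j - a_i a_j)]; after
    symmetrization this is half the sum of the nonnegative terms
    [B i j (ln (b_i b_j) - ln (a_i a_j))(b_i b_j - a_i a_j)], and the diagonal ones
    alone dominate [B i i (b_i - a_i)^2]. Integrating
    [H' <= - c \sum_i |grad u_i|^2] in time, the gradient bound follows from
    [H >= 0] and from the bound on [H(0)] by the maxima of the initial densities. *)
Require Import Defs.
From HB Require Import structures.
From mathcomp Require Import all_boot all_order all_algebra.
From mathcomp Require Import all_classical all_reals all_analysis.
From mathcomp Require Import measurable_realfun ring lra.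
Set Implicit Arguments.
Unset Strict Implicit.
Unset Printing Implicit Defensive.
Import Order.TTheory GRing.Theory Num.Theory.
Import numFieldNormedType.Exports.
Local Open Scope classical_set_scope.
Local Open Scope ring_scope.

(** * One-sided time derivatives through two-sided ones *)

Lemma is_derive1_quotientP (R : realType) (g : R -> R) (t l : R) :
  is_derive t 1 g l <-> (g s - g t) / (s - t) @[s --> t^'] --> l.
Proof.
have quotE : ((fun h => h^-1 *: ((g \o shift t) (h *: 1) - g t)) @ 0^') =
    ((g s - g t) / (s - t) @[s --> t^']).
  rewrite predeqE => P.
  change ((\forall h \near 0^', P (h^-1 *: ((g \o shift t) (h *: 1) - g t))) <->
    (\forall s \near t^', P ((g s - g t) / (s - t)))).
  rewrite !near_withinE.
  rewrite [X in _ <-> X](near_shift 0 t).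
  by split; apply: filterS => s /=;
    rewrite subr0 -(subr_eq0 (s + t)) addrK /GRing.scale /= mulr1 mulrC.
split.
- move=> [dg <-]; rewrite -quotE.
  exact: dg.
- move=> gl; apply: DeriveDef.
    by apply/cvg_ex; exists l; rewrite quotE.
  by apply: cvg_lim => //; rewrite quotE.
Qed.

(* [f] is extended affinely, with slope [l], to the left of 0. *)
Lemma time_derivativeP (R : realType) (f : R -> R) (t l : R) : 0 <= t ->
  time_derivative f t l <->
  exists2 g : R -> R, is_derive t 1 g l & forall s, 0 <= s -> g s = f s.
Proof.
move=> t0; rewrite /time_derivative; split.
- move=> fl; exists (fun s => if 0 <= s then f s else f t + (s - t) * l);
    last by move=> s ->.
  apply/is_derive1_quotientP; rewrite t0.
  apply/cvgrPdist_lt => e e0.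
  move/cvgrPdist_lt : fl => /(_ _ e0).
  rewrite !near_withinE; apply: filterS => s /= H st.
  have [s0|s0] := leP 0 s; first exact: H.
  (* For [s < 0] the difference quotient of the affine piece is exactly [l]. *)
  by rewrite addrAC subrr add0r mulrAC divff ?subr_eq0// mul1r subrr normr0.
- move=> [g /is_derive1_quotientP gl gf].
  apply/cvgrPdist_lt => e e0.
  move/cvgrPdist_lt : gl => /(_ _ e0).
  rewrite !near_withinE; apply: filterS => s /= H s0 st.
  by rewrite -!gf//; exact: H.
Qed.

(** * Entropy dissipation on the periodic grid *)

Lemma sum_mul_laplace (R : realType) (M : nat) (f g : 'I_M -> R) :
  \sum_(k < M) f k * laplace g k =
  - \sum_(k < M) grad_plus f k * grad_plus g k.
Proof.
apply/eqP; rewrite -subr_eq0 opprK -big_split /=; apply/eqP.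
(* [f k * laplace g k + grad_plus f k * grad_plus g k] equals [a k - a (ordS k)], which telescopes
   around the cycle. *)
pose a k := f k * (g (ord_pred k) - g k) / mesh R M ^+ 2.
rewrite (eq_bigr (fun k => a k - a (ordS k))); last first.
  move=> k _; rewrite /a /laplace /grad_plus ordSK expr2 invfM; ring.
by rewrite sumrB [X in X - _](reindex_inj (@ordS_inj M)) subrr.
Qed.

Lemma ln_sub_mul_sub_ge0 (R : realType) (x y : R) : 0 < x -> 0 < y ->
  0 <= (ln y - ln x) * (y - x).
Proof.
move=> x0 y0; have [xy|yx] := leP x y.
  by rewrite mulr_ge0// subr_ge0// ler_ln.
by rewrite mulr_le0// subr_le0 ?ler_ln// ltW.
Qed.

(* From ln z >= 1 - 1/z with z = y/x for x <= y. *)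
Lemma sqr_sub_le_ln_sub_mul_sqr (R : realType) (x y : R) : 0 < x -> 0 < y ->
  (y - x) ^+ 2 <= (ln y - ln x) * (y ^+ 2 - x ^+ 2).
Proof.
wlog xy : x y / x <= y => [hw x0 y0|x0 y0].
  have [xy|/ltW yx] := leP x y; first exact: hw.
  by rewrite -sqrrN opprB -mulrNN !opprB; exact: hw.
have lnxy : (y - x) / y <= ln y - ln x.
  rewrite -ln_div ?posrE// -lerN2 -lnV ?posrE ?divr_gt0// invf_div.
  have -> : x / y = 1 + - ((y - x) / y) by field; rewrite gt_eqF.
  apply: le_ln1Dx; rewrite ltrN2 ltr_pdivrMr// mul1r; lra.
have y2 : 0 <= y ^+ 2 - x ^+ 2 by rewrite subr_sqr mulr_ge0//; lra.
apply: le_trans (ler_wpM2r y2 lnxy).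
rewrite -mulrA expr2 subr_sqr; apply: ler_wpM2l; first by lra.
by rewrite ler_pdivlMl//; nra.
Qed.

(** The inequality on a single edge: [a] and [b] stand for the values of all species at two
    neighbouring grid points, before division by the squared mesh. *)
Lemma cross_diffusion_dissipation (R : realType) (n : nat) (D p a b : 'I_n -> R)
    (A : 'M[R]_n) (c : R) :
  (forall i, 0 <= D i) -> (forall i j, 0 <= A i j) -> (forall i, 0 < p i) ->
  (forall i j, p i * A i j = p j * A j i) -> (forall i, c <= p i * A i i) ->
  (forall i, 0 < a i) -> (forall i, 0 < b i) ->
  c * \sum_(i < n) (b i - a i) ^+ 2 <=
  \sum_(i < n) p i * (ln (b i) - ln (a i)) *
    (D i * (b i - a i) +
     (b i * \sum_(j < n) A i j * b j - a i * \sum_(j < n) A i j * a j)).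
Proof.
move=> D0 A0 p0 dbal cA a0 b0.
pose x i := ln (b i) - ln (a i).
pose S := \sum_(i < n) \sum_(j < n) p i * A i j * x i * (b i * b j - a i * a j).
have S2 : S + S = \sum_(i < n) \sum_(j < n)
    p i * A i j * ((x i + x j) * (b i * b j - a i * a j)).
  (* Swapping [i] and [j] in one copy of [S] leaves the weights unchanged by detailed balance, so
     the logarithmic differences add up. *)
  rewrite {2}/S exchange_big -big_split; apply: eq_bigr => i _.
  rewrite -big_split; apply: eq_bigr => j _ /=.
  rewrite -(dbal i j); ring.
have term_ge0 i j : 0 <= p i * A i j * ((x i + x j) * (b i * b j - a i * a j)).
  apply: mulr_ge0; first by rewrite mulr_ge0// ltW.
  have -> : x i + x j = ln (b i * b j) - ln (a i * a j).
    by rewrite !lnM ?posrE// /x; ring.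
  by apply: ln_sub_mul_sub_ge0; rewrite mulr_gt0.
have cS : c * \sum_(i < n) (b i - a i) ^+ 2 <= S.
  suff : (c * \sum_(i < n) (b i - a i) ^+ 2) *+ 2 <= S + S.
    by rewrite -mulr2n lerMn2r.
  rewrite S2 mulr_sumr -sumrMnl; apply: ler_sum => i _.
  (* Only the diagonal term is kept; there [x i + x i] supplies the factor 2 of the left side. *)
  rewrite (bigD1 i)//= -[leLHS]addr0 lerD//; last by rewrite sumr_ge0.
  have := sqr_sub_le_ln_sub_mul_sqr (a0 i) (b0 i).
  rewrite -/(x i) -!expr2 => h.
  apply: (@le_trans _ _ ((p i * A i i * (b i - a i) ^+ 2) *+ 2)).
    by rewrite lerMn2r/= ler_wpM2r// sqr_ge0.
  rewrite mulrDl -!mulr2n mulrnAr lerMn2r/= ler_wpM2l//.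
  by rewrite mulr_ge0// ltW.
apply: le_trans cS _; apply: ler_sum => i _.
(* The self-diffusion part is nonnegative because [ln] is increasing. *)
rewrite -/(x i) mulrDr -[leLHS]add0r lerD//.
  rewrite mulrCA -mulrA mulr_ge0// mulr_ge0 ?(ltW (p0 i))//.
  exact: ln_sub_mul_sub_ge0.
rewrite !mulr_sumr -sumrB mulr_sumr; apply: ler_sum => j _.
by rewrite le_eqVlt; apply/orP; left; apply/eqP; ring.
Qed.

(** The left side is the time derivative of the entropy along a solution. After summation by parts
    the edge inequality applies to each pair [k], [ordS k]. *)
Lemma entropy_dissipation (R : realType) (n M : nat) (D p : 'I_n -> R)
    (A : 'M[R]_n) (v : 'I_n -> 'I_M -> R) (c : R) :
  (forall i, 0 <= D i) -> (forall i j, 0 <= A i j) -> (forall i, 0 < p i) ->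
  (forall i j, p i * A i j = p j * A j i) -> (forall i, c <= p i * A i i) ->
  (forall i k, 0 < v i k) ->
  \sum_(i < n) mesh R M * \sum_(k < M) p i * (ln (v i k) *
    (D i * laplace (v i) k +
     laplace (fun l => v i l * \sum_(j < n) A i j * v j l) k)) <=
  - (c * \sum_(i < n) mesh R M * \sum_(k < M) `|grad_plus (v i) k| ^+ 2).
Proof.
move=> D0 A0 p0 dbal cA v0.
pose w i l := v i l * \sum_(j < n) A i j * v j l.
pose lnv i l := ln (v i l).
rewrite -!mulr_sumr [c * _]mulrCA -mulrN ler_wpM2l ?invr_ge0//.
have -> : \sum_(i < n) \sum_(k < M) p i * (ln (v i k) *
    (D i * laplace (v i) k + laplace (w i) k)) =
  - \sum_(k < M) \sum_(i < n) p i * grad_plus (lnv i) k *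
      (D i * grad_plus (v i) k + grad_plus (w i) k).
  rewrite exchange_big [in RHS]exchange_big -sumrN exchange_big.
  apply: eq_bigr => i _.
  transitivity (p i * (D i * (\sum_(k < M) lnv i k * laplace (v i) k) +
      \sum_(k < M) lnv i k * laplace (w i) k)).
    rewrite mulr_sumr -big_split mulr_sumr; apply: eq_bigr => k _ /=.
    by rewrite /lnv; ring.
  rewrite !sum_mul_laplace mulrN -opprD mulrN; congr (- _).
  rewrite mulr_sumr -big_split mulr_sumr; apply: eq_bigr => k _ /=; ring.
rewrite lerN2 exchange_big mulr_sumr; apply: ler_sum => k _.
under eq_bigr do rewrite real_normK ?num_real//.
set h := mesh R M.
have := cross_diffusion_dissipation D0 A0 p0 dbal cA
  (fun i => v0 i k) (fun i => v0 i (ordS k)).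
have h2 : 0 <= (h ^+ 2)^-1 by rewrite invr_ge0 sqr_ge0.
(* Dividing by [h ^+ 2] gives each of the two differences in a product its factor [h^-1], which
   makes them forward gradients. *)
move=> /(ler_wpM2r h2); rewrite !mulr_suml.
rewrite mulr_sumr mulr_suml mulr_sumr.
under eq_bigr do rewrite -mulrA -expr_div_n.
under [X in _ <= X -> _]eq_bigr => i _.
  rewrite (_ : _ / h ^+ 2 = p i * grad_plus (lnv i) k *
      (D i * grad_plus (v i) k + grad_plus (w i) k)); last first.
    by rewrite /grad_plus -/h /lnv /w expr2 invfM; ring.
  over.
by [].
Qed.

(** * Differentiation of the entropy in time *)

Lemma is_derive_entropy_density (R : realType) (g : R -> R) (t l : R) :
  0 < g t -> is_derive t 1 g l ->
  is_derive t 1 (fun s => g s * ln (g s) - g s + 1) (ln (g t) * l).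
Proof.
move=> gt0 dg.
have dln : is_derive t 1 (@ln R \o g) ((g t)^-1 * l).
  by apply: is_derive1_comp; exact: is_derive1_ln.
rewrite (_ : (fun s => _) = g * (@ln R \o g) - g + cst 1)//.
apply: is_derive_eq.
by rewrite /GRing.scale /= mulrA divff ?gt_eqF//; ring.
Qed.

Lemma time_derivative_entropy (R : realType) (n M : nat) (p : 'I_n -> R)
    (u : R -> 'I_n -> 'I_M -> R) (t : R) (l : 'I_n -> 'I_M -> R) : 0 <= t ->
  (forall i k, 0 < u t i k) ->
  (forall i k, time_derivative (fun s => u s i k) t (l i k)) ->
  time_derivative (fun s => entropy p (u s)) t
    (\sum_(i < n) mesh R M * \sum_(k < M) p i * (ln (u t i k) * l i k)).
Proof.
move=> t0 ut0 dut.
(* Each component is replaced by a function with a two-sided derivative at [t], so that the usual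
   chain rule also covers [t = 0]. *)
have gP (ik : 'I_n * 'I_M) : {g : R -> R | is_derive t 1 g (l ik.1 ik.2) /\
    forall s, 0 <= s -> g s = u s ik.1 ik.2}.
  apply: cid; have [g dg gu] := proj1 (time_derivativeP _ _ t0) (dut ik.1 ik.2).
  by exists g.
pose g i k := projT1 (gP (i, k)).
have dg i k : is_derive t 1 (g i k) (l i k) by case: (projT2 (gP (i, k))).
have gu i k s : 0 <= s -> g i k s = u s i k.
  by case: (projT2 (gP (i, k))) => _; exact.
apply/(time_derivativeP _ _ t0).
pose dens i k s := g i k s * ln (g i k s) - g i k s + 1.
exists (\sum_(i < n) (mesh R M *: \sum_(k < M) (p i *: dens i k))).
  apply: is_derive_sum => i; apply: is_deriveZ.
  apply: is_derive_sum => k; apply: is_deriveZ.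
  rewrite -(gu _ _ _ t0); apply: is_derive_entropy_density => //.
  by rewrite gu.
move=> s s0; rewrite fct_sumE; apply: eq_bigr => i _.
rewrite /GRing.scale /= fct_sumE; congr (_ * _); apply: eq_bigr => k _.
by rewrite /GRing.scale /= /dens gu.
Qed.

Lemma continuous_sum (R : realType) (n : nat) (f : 'I_n -> R -> R) :
  (forall i, continuous (f i)) -> continuous (fun x => \sum_(i < n) f i x).
Proof. move=> fc; apply: continuous_big => //; exact: add_continuous. Qed.

(** The even extension is continuous on all of [R], even though it may have a corner at 0: near each
    point it factors through the absolute value and a function differentiable at [|t|]. *)
Lemma time_derivative_continuous (R : realType) (f : R -> R) :
  (forall t, 0 <= t -> exists l, time_derivative f t l) ->
  continuous (fun t : R => f `|t|).
Proof.
move=> df t; have [l /(time_derivativeP _ _ (normr_ge0 t)) [g dg gf]] := df _ (normr_ge0 t).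
rewrite (_ : (fun t => _) = g \o (fun s : R => `|s|)); last by apply/funext => s /=; rewrite gf.
apply: continuous_comp; first exact: norm_continuous.
by apply: differentiable_continuous; apply/derivable1_diffP; case: dg.
Qed.

(** * Bounds that are uniform in the mesh *)

Lemma exists_pos_lower_bound (R : realType) (n : nat) (f : 'I_n -> R) :
  (forall i, 0 < f i) -> exists2 c : R, 0 < c & forall i, c <= f i.
Proof.
(* The default value 1 keeps the minimum positive when the index set is empty. *)
move=> f0; exists (\big[Num.min/1]_(i < n) f i).
  by apply: (big_ind (fun x => 0 < x)) => // x y x0 y0; rewrite lt_min x0.
by move=> i; rewrite (bigD1 i)//= ge_min lexx.
Qed.

Lemma mesh_sum_le (R : realType) (M : nat) (f : 'I_M -> R) (K : R) :
  (0 < M)%N -> (forall k, f k <= K) -> mesh R M * \sum_(k < M) f k <= K.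
Proof.
move=> M0 fK; rewrite /mesh ler_pdivrMl ?ltr0n//.
apply: (@le_trans _ _ (\sum_(k < M) K)); first exact: ler_sum.
by rewrite sumr_const card_ord mulr_natl.
Qed.

(** All grid points lie in [[0, 1]], where each continuous entropy density attains a maximum; a grid
    average never exceeds it, whatever [M] is. *)
Lemma initial_entropy_bound (R : realType) (n : nat) (p : 'I_n -> R)
    (u0 : 'I_n -> R -> R) :
  (forall i, continuous (u0 i)) -> (forall i x, 0 < u0 i x) ->
  exists K : R, forall M, (0 < M)%N ->
    entropy p (fun i (k : 'I_M) => u0 i (gridpt R k)) <= K.
Proof.
move=> u0c u0p.
pose f i x := p i * (u0 i x * ln (u0 i x) - u0 i x + 1).
have fc i : continuous (f i).
  move=> x; apply: cvgMr; apply: cvgD; last exact: cvg_cst.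
  apply: cvgB; last exact: u0c.
  apply: cvgM; first exact: u0c.
  by apply: continuous_comp; [exact: u0c|exact: continuous_ln].
have fmax i : {K : R | forall x, x \in `[0, 1] -> f i x <= K}.
  apply: cid; have [c _ cP] := EVT_max ler01 (continuous_subspaceT (@fc i)).
  by exists (f i c).
exists (\sum_(i < n) projT1 (fmax i)) => M M0; apply: ler_sum => i _.
apply: mesh_sum_le => // k; apply: (projT2 (fmax i)).
rewrite in_itv /= /gridpt /mesh divr_ge0//= ler_pdivrMr ?ltr0n// mul1r ler_nat.
exact/ltnW.
Qed.

(** Multiplying [ln z^-1 <= z^-1 - 1] by [z > 0] gives [z * ln z - z + 1 >= 0]. *)
Lemma entropy_ge0 (R : realType) (n M : nat) (p : 'I_n -> R)
    (v : 'I_n -> 'I_M -> R) :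
  (forall i, 0 < p i) -> (forall i k, 0 < v i k) -> 0 <= entropy p v.
Proof.
move=> p0 v0; apply: sumr_ge0 => i _.
rewrite mulr_ge0 ?invr_ge0//; apply: sumr_ge0 => k _.
apply: mulr_ge0; first exact/ltW.
have lnv : ln (v i k)^-1 <= (v i k)^-1 - 1.
  rewrite -[leLHS](_ : ln (1 + ((v i k)^-1 - 1)) = _); last by rewrite addrC subrK.
  by apply: le_ln1Dx; rewrite ltrBrDr addrC subrr invr_gt0.
move/(ler_wpM2l (ltW (v0 i k))) : lnv.
by rewrite lnV ?posrE// mulrBr divff ?gt_eqF//; lra.
Qed.

(** * Integration in time and the final estimates *)

(** The integrand is at most [- c^-1 * dH t], whose integral is given by the fundamental theorem of
    calculus. Differentiability is asked for [t > 0] only, since an even extension may have a corner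
    at 0. *)
Lemma dissipation_integral_bound (R : realType) (n : nat) (H dH : R -> R)
    (G : 'I_n -> R -> R) (c T : R) :
  0 < c -> 0 < T -> continuous H -> continuous dH ->
  (forall i, continuous (G i)) -> (forall i t, 0 <= G i t) ->
  (forall t : R, 0 < t -> is_derive t 1 H (dH t)) ->
  (forall t, dH t <= - (c * \sum_(i < n) G i t)) ->
  (\sum_(i < n) \int[lebesgue_measure]_(t in `[0%R, T]) (G i t)%:E
     <= ((H 0 - H T) / c)%:E)%E.
Proof.
move=> c0 T0 Hc dHc Gc G0 dH_H dHG.
have mG (g : R -> R) : continuous g ->
    measurable_fun `[0, T] (fun x => (g x)%:E).
  move=> gc; apply/measurable_EFinP; apply: measurable_funTS.
  exact: continuous_measurable_fun.
rewrite -ge0_integral_sum//; [|by move=> i; exact: mG|by move=> i x _; rewrite lee_fin].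
have kc : continuous (fun t : R => - c^-1 * dH t).
  by move=> t; apply: cvgMr; exact: dHc.
have kHc : continuous (fun t : R => - c^-1 * H t).
  by move=> t; apply: cvgMr; exact: Hc.
have kD (t : R) : 0 < t -> is_derive t 1 (fun t => - c^-1 * H t) (- c^-1 * dH t).
  by move=> t0; apply: is_deriveZ; exact: dH_H.
apply: (@le_trans _ _ (\int[lebesgue_measure]_(t in `[0%R, T])
    (- c^-1 * dH t)%:E)%E).
  apply: ge0_le_integral => //.
  - by move=> x _; apply: sume_ge0 => i _; rewrite lee_fin.
  - by apply: emeasurable_sum => i; exact: mG.
  - exact: mG.
  - move=> t _; rewrite sumEFin lee_fin mulNr -mulrN ler_pdivlMl//.
    by rewrite lerNr.
rewrite (@continuous_FTC2 _ _ (fun t : R => - c^-1 * H t))//.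
- by rewrite -EFinB lee_fin le_eqVlt; apply/orP; left; apply/eqP; ring.
- exact: continuous_subspaceT.
- split.
  + by move=> x; rewrite in_itv/= => /andP[x0 _]; case: (kD _ x0).
  + by apply: cvg_at_right_filter; exact: kHc.
  + by apply: cvg_at_left_filter; exact: kHc.
- move=> x; rewrite in_itv/= => /andP[x0 _].
  by rewrite derive1E; case: (kD _ x0).
Qed.

Lemma time_derivative_is_derive (R : realType) (f : R -> R) (t l : R) : 0 < t ->
  time_derivative f t l -> is_derive t 1 (fun s : R => f `|s|) l.
Proof.
move=> t0 /(time_derivativeP _ _ (ltW t0)) [g dg gf].
apply: near_eq_is_derive dg; near=> s.
have s0 : 0 < s by near: s; exact: lt_nbhsr.
by rewrite gtr0_norm// gf// ltW.
Unshelve. all: by end_near. Qed.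

Theorem lemma9 (R : realType) (n : nat) (hn : (2 <= n)%N)
    (D : 'I_n -> R) (A : 'M[R]_n) (p : 'I_n -> R) (u0 : 'I_n -> R -> R)
    (D_ge0 : forall i, 0 <= D i)
    (A_ge0 : forall i j, 0 <= A i j)
    (A_diag_gt0 : forall i, 0 < A i i)
    (p_gt0 : forall i, 0 < p i)
    (detailed_balance : forall i j, p i * A i j = p j * A j i)
    (u0_cont : forall i, torus_continuous (u0 i))
    (u0_gt0 : forall i x, 0 < u0 i x) :
  forall T : R, 0 < T ->
  exists2 C : R, 0 < C &
    forall (M : nat) (u : R -> 'I_n -> 'I_M -> R),
      (1 <= M)%N -> positive_global_solution D A u0 u ->
      [/\ (\sum_(i < n) \int[lebesgue_measure]_(t in `[0%R, T])
             (mesh R M * \sum_(k < M) `|grad_plus (u t i) k| ^+ 2)%:E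
             <= C%:E)%E,
          forall t : R, 0 <= t ->
            exists2 d : R,
              time_derivative (fun s => entropy p (u s)) t d & d <= 0
        & (ereal_sup [set (entropy p (u t))%:E | t in `[0%R, T]] <= C%:E)%E].
Proof.
have [c c0 cA] := exists_pos_lower_bound (fun i => mulr_gt0 (p_gt0 i) (A_diag_gt0 i)).
have [K KP] := initial_entropy_bound p (fun i => (u0_cont i).2) u0_gt0.
(* [|K|] bounds the initial entropy and [|K| / c] the gradient integral; the 1 makes the constant
   positive. Both [K] and [c] are fixed before [M] and [u]. *)
move=> T T0; exists (1 + `|K| + `|K| / c).
  by rewrite -addrA ltr_pwDl// addr_ge0// divr_ge0// ltW.
move=> M u M1 [u_init u_gt0 u_deriv].
pose rhs v i k := D i * laplace (v i) k +
  laplace (fun l : 'I_M => v i l * \sum_(j < n) A i j * v j l) k.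
pose dE v := \sum_(i < n) mesh R M * \sum_(k < M) p i * (ln (v i k) * rhs v i k).
(* Precomposing with [`|t|] extends the solution evenly to all of R, where it
   is still continuous and positive. *)
pose H (t : R) := entropy p (u `|t|).
pose dH (t : R) := dE (u `|t|).
pose G i (t : R) := mesh R M * \sum_(k < M) `|grad_plus (u `|t| i) k| ^+ 2.
have G_ge0 i (t : R) : 0 <= G i t.
  by rewrite mulr_ge0 ?invr_ge0// sumr_ge0// => k _; exact: sqr_ge0.
have E_deriv t : 0 <= t -> time_derivative (fun s => entropy p (u s)) t (dE (u t)).
  move=> t0; apply: time_derivative_entropy => // i k; first exact: u_gt0.
  exact: u_deriv.
have dHG t : dH t <= - (c * \sum_(i < n) G i t).
  by apply: entropy_dissipation => // i k; exact: u_gt0.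
have H_cont : continuous H.
  apply: (time_derivative_continuous (f := fun s => entropy p (u s))) => t t0.
  by exists (dE (u t)); exact: E_deriv.
have u_cont i k : continuous (fun t : R => u `|t| i k).
  apply: (time_derivative_continuous (f := fun t => u t i k)) => t t0.
  by eexists; exact: u_deriv.
have lap_cont (w : R -> 'I_M -> R) k : (forall l, continuous (w^~ l)) ->
    continuous (fun t => laplace (w t) k).
  move=> wc t; apply: cvgMl; apply: cvgB; last by apply: cvgMr; exact: wc.
  by apply: cvgD; exact: wc.
have G_cont i : continuous (G i).
  move=> t; apply: cvgMr; apply: continuous_sum => k {}t.
  have norm_cvg : `|grad_plus (u `|s| i) k| @[s --> t] --> `|grad_plus (u `|t| i) k|.
    by apply: cvg_norm; apply: cvgMl; apply: cvgB; exact: u_cont.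
  exact: (cvgM norm_cvg norm_cvg).
have dH_cont : continuous dH.
  apply: continuous_sum => i t; apply: cvgMr; apply: continuous_sum => k {}t.
  apply: cvgMr; apply: cvgM.
    by apply: continuous_comp; [exact: u_cont|apply: continuous_ln; exact: u_gt0].
  apply: cvgD; first by apply: cvgMr; apply: lap_cont => l; exact: u_cont.
  apply: lap_cont => l {}t; apply: cvgM; first exact: u_cont.
  by apply: continuous_sum => j {}t; apply: cvgMr; exact: u_cont.
have H_deriv (t : R) : 0 < t -> is_derive t 1 H (dH t).
  move=> t0; rewrite /dH gtr0_norm//.
  by apply: (time_derivative_is_derive (f := fun s => entropy p (u s))) => //;
    exact: E_deriv (ltW t0).
(* The final time is left free: [S = T] yields the gradient bound, and [S = t] the decay of the
   entropy. *)
have Gint (S : R) (S0 : 0 < S) := dissipation_integral_bound c0 S0 H_cont dH_cont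
  G_cont G_ge0 H_deriv dHG.
have H_ge0 (t : R) : 0 <= H t.
  by apply: entropy_ge0 => // i k; exact: u_gt0.
have H0K : H 0 <= `|K|.
  apply: le_trans (ler_norm K).
  rewrite /H normr0 (_ : u 0 = fun i k => u0 i (gridpt R k)); first exact: KP.
  by apply/funext => i; apply/funext => k; exact: u_init.
have H_le (t : R) : 0 <= t -> H t <= H 0.
  rewrite le_eqVlt => /predU1P[<-//|t0].
  (* [(H 0 - H t) / c] dominates an integral of nonnegative functions. *)
  rewrite -subr_ge0 -(pmulr_lge0 _ (_ : 0 < c^-1)) ?invr_gt0// -lee_fin.
  apply: le_trans (Gint _ t0).
  by apply: sume_ge0 => i _; apply: integral_ge0 => s _; rewrite lee_fin.
split.
- apply: (@le_trans _ _ ((H 0 - H T) / c)%:E).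
    apply: le_trans (Gint _ T0).
    rewrite le_eqVlt; apply/orP; left; apply/eqP; apply: eq_bigr => i _.
    apply: eq_integral => t; rewrite inE/= in_itv/= => /andP[t0 _].
    by rewrite /G ger0_norm.
  (* [H T >= 0] is dropped and [H 0] is bounded by [|K|]. *)
  rewrite lee_fin -[leLHS]add0r lerD ?addr_ge0//.
  by rewrite ler_wpM2r ?invr_ge0 ?(ltW c0)// lerBlDr ler_wpDr.
- move=> t t0; exists (dE (u t)); first exact: E_deriv.
  have := dHG t; rewrite /dH ger0_norm// => /le_trans; apply.
  by rewrite oppr_le0 mulr_ge0 ?(ltW c0)// sumr_ge0.
- apply: ge_ereal_sup => _ [t /= + <-]; rewrite in_itv/= => /andP[t0 _].
  rewrite lee_fin -(ger0_norm t0); apply: le_trans (H_le _ t0) _.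
  apply: le_trans H0K _; rewrite -addrA addrCA ler_wpDr// addr_ge0//.
  by rewrite divr_ge0// ltW.
Qed.
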